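(* Let $s$ be a degree sequence and let $U,U'\in\mathcal{U}(s)$. Then there exists a u-switch sequence transforming $U$ into $U'$; that is, there are 2-switches $\tau_1,\dots,\tau_k$ ($k\ge 0$) such that, with $U_0=U$ and $U_i=\tau_i(U_{i-1})$, each $\tau_i$ is a u-switch over $U_{i-1}$ and $U_k=U'$. In particular every intermediate graph $U_i$ is a unicyclic graph with degree sequence $s$.
   Context: All graphs are finite, simple, undirected and labeled, with vertex set $[n]=\{1,\dots,n\}$. The degree sequence of a graph $G$ with $V(G)=[n]$ is $s(G)=(d_1,\dots,d_n)$ where $d_i$ is the degree of vertex $i$; so two graphs have the same degree sequence iff every vertex has the same degree in both. A graph is unicyclic if it is connected and contains exactly one cycle; $\mathcal{U}(s)$ denotes the set of unicyclic graphs with degree sequence $s$. For $a,b,c,d\in[n]$, the matrix $A=\binom{a\ b}{c\ d}$ is interchangeable in $G$ if $ab,cd\in E(G)$, $\{a,b\}\cap\{c,d\}=\varnothing$ and $ac,bd\notin E(G)$. The 2-switch $\tau_A$ is the map sending $G$ to $G-ab-cd+ac+bd$ if $A$ is interchangeable in $G$, and to $G$ otherwise (in which case $\tau_A$ is trivial for $G$). A nontrivial 2-switch $\tau$ over a unicyclic graph $U$ is a u-switch if $\tau(U)$ is unicyclic. The empty sequence counts as a u-switch sequence. *)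

(* Defs.v *)
From mathcomp Require Import all_boot.
Set Implicit Arguments. Unset Strict Implicit. Unset Printing Implicit Defensive.

(* A simple labeled graph on vertex set 'I_n (= [n] shifted to {0..n-1}) is
   given by its edge set: a set of unordered pairs {x,y} with x <> y. *)
Definition graph (n : nat) := {set {set 'I_n}}.

Definition simple_graph n (G : graph n) : bool :=
  [forall e in G, #|e| == 2].

Definition adj n (G : graph n) (x y : 'I_n) : bool := [set x; y] \in G.

Definition deg n (G : graph n) (v : 'I_n) : nat := #|[set e in G | v \in e]|.

Definition degseq n (G : graph n) : {ffun 'I_n -> nat} := [ffun v => deg G v].

Definition connected n (G : graph n) : bool :=
  [forall x, forall y, connect (adj G) x y].

Definition is_cycle n (G : graph n) (C : graph n) : bool :=
  [&& C \subset G, C != set0,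
      [forall v, (v \in cover C) ==> (deg C v == 2)] &
      [forall x in cover C, forall y in cover C, connect (adj C) x y]].

Definition unicyclic n (G : graph n) : bool :=
  [&& simple_graph G, connected G & #|[set C : graph n | is_cycle G C]| == 1].

Definition edge n (x y : 'I_n) : {set 'I_n} := [set x; y].

Definition interchangeable n (G : graph n) (a b c d : 'I_n) : bool :=
  [&& adj G a b, adj G c d, [disjoint [set a; b] & [set c; d]],
      ~~ adj G a c & ~~ adj G b d].

Definition two_switch n (a b c d : 'I_n) (G : graph n) : graph n :=
  if interchangeable G a b c d then
    (G :\ edge a b :\ edge c d) :|: [set edge a c; edge b d]
  else G.

Definition u_switch n (a b c d : 'I_n) (U : graph n) : bool :=
  interchangeable U a b c d && unicyclic (two_switch a b c d U).

Fixpoint u_switch_seq n (U : graph n) (taus : seq ('I_n * 'I_n * 'I_n * 'I_n))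
  (U' : graph n) : bool :=
  match taus with
  | [::] => U == U'
  | (a, b, c, d) :: taus' =>
      u_switch a b c d U && u_switch_seq (two_switch a b c d U) taus' U'
  end.

(* Main.v *)
(** A connected graph on [n] vertices is unicyclic iff it has [n] edges, and
    2-switches preserve degrees, so it suffices to join [U] to [U'] by 2-switches
    that preserve connectivity.  This is done for connected graphs on a vertex set
    [W] with at most [#|W|] edges, by induction on [W]: choose [v] so that deleting
    it leaves both graphs connected, make the neighbourhoods of [v] equal, delete
    [v], and lift the switches obtained on [W :\ v] by putting back the star at [v].

    The exchange step: suppose [va] is an edge, [vb] is not, [deg a <= deg b] and
    [a], [b] are joined in [G - va].  Then [b] has a neighbour [x], not adjacent to
    [a], such that [a] and [b] are still joined in [G - va - bx]; hence replacing
    [va], [bx] by [vb], [ax] keeps [G] connected.  If [W] contains a leaf [v], the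
    degree condition holds in one of the two graphs, and 2-switches are reversible.
    If it does not, every degree is 2 and no edge is a bridge. *)
Require Import Defs.
From mathcomp Require Import all_boot.
Set Implicit Arguments. Unset Strict Implicit. Unset Printing Implicit Defensive.

(** * Connectivity under maps, and unordered pairs *)

(** An edge may be sent to a path or collapsed. This serves both the retraction of a leaf and the
    lifting of switch sequences, where the vertices of the relation are whole graphs. *)
Lemma connect_homo (T T' : finType) (e : rel T) (e' : rel T') (f : T -> T') :
  (forall x y, e x y -> connect e' (f x) (f y)) ->
  forall x y, connect e x y -> connect e' (f x) (f y).
Proof.
move=> fe x y /connectP[p]; elim: p x => [|z p IHp] x /=; first by move=> _ ->.
by case/andP=> /fe xz zp yE; apply: connect_trans xz (IHp _ zp yE).
Qed.

Lemma eq_set2 (T : finType) (a b c d : T) :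
  ([set a; b] == [set c; d]) = (a == c) && (b == d) || (a == d) && (b == c).
Proof.
apply/eqP/idP => [E|/orP[]/andP[/eqP-> /eqP->] //]; last exact: setUC.
have: [&& a \in [set c; d], b \in [set c; d], c \in [set a; b] & d \in [set a; b]].
  by rewrite E -{1 2}E !inE !eqxx !orbT.
rewrite !inE [c == a]eq_sym [c == b]eq_sym [d == a]eq_sym [d == b]eq_sym.
by case: (a == c); case: (a == d); case: (b == c); case: (b == d).
Qed.

Section Graphs.
Variable n : nat.
Implicit Types (G H T C : graph n) (W N : {set 'I_n}) (v w x y a b c d : 'I_n).

(** * Adjacency and degrees *)

Definition nbr G v := [set w | adj G v w].

Lemma adjC G x y : adj G x y = adj G y x.
Proof. by rewrite /adj setUC. Qed.

Lemma adj_connect_sym G : connect_sym (adj G).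
Proof. by apply: sym_connect_sym => x y; apply: adjC. Qed.

Lemma adj_neq G x y : simple_graph G -> adj G x y -> x != y.
Proof. by move=> /forall_inP sG /sG; rewrite cards2; case: (x != y). Qed.

Lemma simple_edge G e :
  simple_graph G -> e \in G -> exists x y, [/\ x != y, adj G x y & e = [set x; y]].
Proof.
move=> /forall_inP sG eG; have /cards2P[x [y [xy E]]] := sG _ eG.
by exists x, y; rewrite /adj -E.
Qed.

Lemma simple_sub G H : H \subset G -> simple_graph G -> simple_graph H.
Proof. by move=> /subsetP sHG /forall_inP sG; apply/forall_inP => e /sHG /sG. Qed.

(** Sets that are not pairs are invisible to [adj]; simplicity excludes them. *)
Lemma graph_eq G H :
  simple_graph G -> simple_graph H -> (forall x y, adj G x y = adj H x y) -> G = H.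
Proof.
move=> sG sH E; apply/setP => e; apply/idP/idP.
  by case/(simple_edge sG)=> x [y [_ + ->]]; rewrite E.
by case/(simple_edge sH)=> x [y [_ + ->]]; rewrite -E.
Qed.

Lemma adjD1 G a b x y :
  adj (G :\ edge a b) x y =
  ~~ ((x == a) && (y == b) || (x == b) && (y == a)) && adj G x y.
Proof. by rewrite /adj in_setD1 /edge eq_set2. Qed.

Lemma adjD1_avoid G a b c x y :
  c \in [set a; b] -> x != c -> y != c -> adj G x y -> adj (G :\ edge a b) x y.
Proof.
rewrite adjD1 => cab xc yc ->; rewrite andbT; move: cab xc yc.
by rewrite !inE => /orP[]/eqP-> /negPf-> /negPf->; rewrite ?andbF.
Qed.

Lemma adj_sub G H x y : H \subset G -> adj H x y -> adj G x y.
Proof. by move=> /subsetP; apply. Qed.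

Lemma connect_adj_sub G H x y :
  H \subset G -> connect (adj H) x y -> connect (adj G) x y.
Proof. by move=> sHG; apply: connect_sub => u w /(adj_sub sHG) /connect1. Qed.

Lemma deg_nbr G v : simple_graph G -> deg G v = #|nbr G v|.
Proof.
move=> sG; rewrite /deg -(card_in_imset (f := fun w => [set v; w]) (D := mem (nbr G v))).
  apply: eq_card => e; rewrite !inE; apply/andP/imsetP.
    case=> /(simple_edge sG)[x [y [xy xyG ->]]]; rewrite !inE => /orP[]/eqP->.
      by exists y; rewrite ?inE.
    by exists x; rewrite ?inE 1?adjC // setUC.
  by case=> w; rewrite !inE => vw ->; rewrite !inE eqxx.
move=> w w'; rewrite !inE => /(adj_neq sG) vw /(adj_neq sG) vw' /eqP.
by rewrite eq_set2 eqxx (negPf vw') /= orbF => /eqP.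
Qed.

Lemma deg_sum G v : deg G v = \sum_(e in G) (v \in e).
Proof.
rewrite /deg -sum1_card big_mkcond [RHS]big_mkcond /=.
by apply: eq_bigr => e _; rewrite inE; case: (e \in G); case: (v \in e).
Qed.

(** * Degree sums and bridges *)

(** Double counting of incidences. With [K] a component this yields a parity argument; with [K] the
    whole vertex set, twice the number of edges. *)
Lemma handshake G (K : {set 'I_n}) :
  \sum_(v in K) deg G v = \sum_(e in G) #|e :&: K|.
Proof.
under eq_bigr do rewrite deg_sum.
rewrite exchange_big /=; apply: eq_bigr => e _.
rewrite -sum1_card big_mkcond [RHS]big_mkcond /=.
by apply: eq_bigr => v _; rewrite inE andbC; case: (v \in K); case: (v \in e).
Qed.

Lemma degD1 G v e : e \in G -> deg G v = (v \in e) + deg (G :\ e) v.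
Proof. by move=> eG; rewrite !deg_sum (big_setD1 e). Qed.

Lemma degU1 G v e : e \notin G -> deg (e |: G) v = (v \in e) + deg G v.
Proof. by move=> eG; rewrite !deg_sum big_setU1. Qed.

(** If [xy] were a bridge, let [K] be the component of [x] in [G] minus [xy]. The edge [xy] meets
    [K] once and every other edge 0 or 2 times, so the degree sum over [K] would be odd. *)
Lemma even_nonbridge G x y :
  simple_graph G -> (forall v, 2 %| deg G v) -> adj G x y ->
  connect (adj (G :\ edge x y)) x y.
Proof.
move=> sG evG xy; set H := G :\ _; apply/negPn/negP => nxy.
pose K := [set z | connect (adj H) x z].
have: 2 %| \sum_(v in K) deg G v by apply: dvdn_sum => v _.
rewrite handshake (big_setD1 (edge x y)) //= dvdn_addl.
  have -> : edge x y :&: K = [set x].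
    apply/setP=> z; rewrite !inE; case: eqP => [->|_] /=; first exact: connect0.
    by case: eqP => [->|//]; apply/negbTE.
  by rewrite cards1.
apply: dvdn_sum => e eH.
have [u [w [uw adjuw ->]]] := simple_edge (simple_sub (subsetDl _ _) sG) eH.
have Kuw : (u \in K) = (w \in K).
  by rewrite !inE (same_connect_r (@adj_connect_sym H) (connect1 adjuw)).
have [uK|uK] := boolP (u \in K).
  rewrite (_ : _ :&: _ = [set u; w]) ?cards2 ?uw //.
  by apply/setIidPl; rewrite subUset !sub1set -Kuw uK.
rewrite (_ : _ :&: _ = set0) ?cards0 //; apply/setP=> z; rewrite in_set0 in_setI in_set2.
by apply/negP=> /andP[/orP[]/eqP->]; rewrite -?Kuw (negPf uK).
Qed.

(** Each use of the deleted edge is replaced by the detour from [x] to [y]. *)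
Lemma connect_setD1 G x y :
  connect (adj (G :\ edge x y)) x y ->
  forall u w, connect (adj G) u w -> connect (adj (G :\ edge x y)) u w.
Proof.
move=> xy; apply: connect_sub => u w uw.
have [|nE] := boolP ((u == x) && (w == y) || (u == y) && (w == x)).
  by case/orP=> /andP[/eqP-> /eqP->] //; rewrite adj_connect_sym.
by apply: connect1; rewrite adjD1 nE.
Qed.

(** * 2-switches *)

Lemma interchangeable_uniq G a b c d :
  simple_graph G -> interchangeable G a b c d -> uniq [:: a; b; c; d].
Proof.
move=> sG /and5P[/(adj_neq sG) ab /(adj_neq sG) cd dis _ _].
have: a \notin [set c; d] by rewrite (disjointFr dis) ? set21.
have: b \notin [set c; d] by rewrite (disjointFr dis) ? set22.
by rewrite !inE /= !inE !negb_or ab cd => /andP[-> ->] /andP[-> ->].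
Qed.

Lemma interchangeableI G a b c d :
  adj G a b -> adj G c d -> uniq [:: a; b; c; d] ->
  ~~ adj G a c -> ~~ adj G b d -> interchangeable G a b c d.
Proof.
rewrite /= !inE !negb_or => ab cd /and4P[/and3P[_ ac ad] /andP[bc bd] _ _] nac nbd.
apply/and5P; split=> //; rewrite disjoints_subset; apply/subsetP => z.
by rewrite !inE => /orP[]/eqP->; rewrite negb_or ?ac ?ad ?bc ?bd.
Qed.

Lemma adj_two_switch G a b c d x y :
  interchangeable G a b c d ->
  adj (two_switch a b c d G) x y =
  [|| [&& ~~ ((x == a) && (y == b) || (x == b) && (y == a)),
          ~~ ((x == c) && (y == d) || (x == d) && (y == c)) & adj G x y],
      (x == a) && (y == c) || (x == c) && (y == a) |
      (x == b) && (y == d) || (x == d) && (y == b)].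
Proof.
rewrite /two_switch => ->; rewrite /adj /edge !inE !eq_set2.
by congr (_ || _); rewrite andbCA.
Qed.

Lemma two_switch_simple G a b c d :
  simple_graph G -> simple_graph (two_switch a b c d G).
Proof.
move=> sG; rewrite /two_switch; case: ifP => // /(interchangeable_uniq sG).
rewrite /= !inE !negb_or => /and4P[/and3P[_ ac _] /andP[_ bd] _ _].
apply/forall_inP => e; rewrite !inE => /orP[/and3P[_ _ /(forall_inP sG)]|] //.
by case/orP=> /eqP->; rewrite /edge cards2 ?ac ?bd.
Qed.

Lemma two_switchE G a b c d : interchangeable G a b c d ->
  two_switch a b c d G = edge a c |: (edge b d |: (G :\ edge a b :\ edge c d)).
Proof. by rewrite /two_switch => ->; rewrite setUA setUC. Qed.

(** Both graphs are two edges added to the same remainder, and each of the four distinct vertices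
    lies on exactly one added edge in either case. *)
Lemma deg_two_switch G a b c d v :
  simple_graph G -> deg (two_switch a b c d G) v = deg G v.
Proof.
move=> sG; have [I|nI] := boolP (interchangeable G a b c d); last first.
  by rewrite /two_switch (negPf nI).
rewrite two_switchE //; have U := interchangeable_uniq sG I.
have /and5P[ab cd _ ac bd] := I.
move: U; rewrite /= !inE !negb_or => /and4P[/and3P[nab nac nad] /andP[nbc nbd] ncd _].
have cdG : edge c d \in G :\ edge a b.
  rewrite in_setD1 (cd : edge c d \in G) /edge eq_set2.
  by rewrite ![_ == a]eq_sym (negPf nac) (negPf nad) /= andbF.
rewrite degU1; last first.
  rewrite !inE (negPf (ac : edge a c \notin G)) !andbF orbF /edge eq_set2.
  by rewrite (negPf nab) (negPf nad).
rewrite degU1; last by rewrite !inE (negPf (bd : edge b d \notin G)) !andbF.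
rewrite (degD1 v (ab : edge a b \in G)) (degD1 v cdG) !addnA; congr (_ + _).
rewrite /edge !inE; case: (v =P a) => [->|_]; first by rewrite (negPf nab) (negPf nac) (negPf nad).
case: (v =P b) => [->|_]; first by rewrite (negPf nbc) (negPf nbd).
case: (v =P c) => [->|_]; first by rewrite (negPf ncd).
by case: eqP.
Qed.

(** The inverse switch removes [ac], [bd] and restores [ab], [cd]. It makes the step relation below
    symmetric. *)
Lemma two_switchK G a b c d : simple_graph G -> interchangeable G a b c d ->
  interchangeable (two_switch a b c d G) a c b d /\
  two_switch a c b d (two_switch a b c d G) = G.
Proof.
move=> sG I; have U := interchangeable_uniq sG I; have /and5P[ab cd _ ac bd] := I.
have I' : interchangeable (two_switch a b c d G) a c b d.
  move: U; rewrite /= !inE !negb_or => /and4P[/and3P[nab nac nad] /andP[nbc nbd] ncd _].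
  apply: interchangeableI; rewrite ?adj_two_switch // ?eqxx ?orbT //=.
  - by rewrite !inE !negb_or nac nab nad ncd nbd [c == b]eq_sym nbc.
  - by rewrite (negPf nbc) (negPf nac) (negPf nab) (negPf nad).
  - by rewrite (negPf ncd) [c == a]eq_sym [d == a]eq_sym [c == b]eq_sym (negPf nac) (negPf nad) (negPf nbc) andbF.
split=> //; apply: graph_eq => [||x y] //; first by do 2!apply: two_switch_simple.
rewrite !adj_two_switch //.
have eT u w : (x == u) && (y == w) || (x == w) && (y == u) -> adj G x y = adj G u w.
  by case/orP=> /andP[/eqP-> /eqP->] //; apply: adjC.
(* The pair [x], [y] is compared with the four switched pairs in turn; on any other pair neither
   switch changes adjacency. *)
case: (boolP (_ && _ || _)) (eT a b) => [_ /(_ isT)->|_ _]; first by rewrite ab !orbT.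
case: (boolP (_ && _ || _)) (eT c d) => [_ /(_ isT)->|_ _]; first by rewrite cd !orbT.
case: (boolP (_ && _ || _)) (eT a c) => [_ /(_ isT)->|_ _]; first by rewrite (negPf ac).
case: (boolP (_ && _ || _)) (eT b d) => [_ /(_ isT)->|_ _]; first by rewrite (negPf bd).
by rewrite ?orbF ?andbT.
Qed.


(** * Connectivity-preserving switches *)

(** The vertex type stays fixed while the induction deletes vertices, so the current vertex set [W]
    is carried along; vertices outside it are isolated. *)
Definition connected_on W G :=
  [&& simple_graph G, [forall e in G, e \subset W] &
      [forall x in W, forall y in W, connect (adj G) x y]].

Lemma connected_onP W G :
  reflect [/\ simple_graph G, forall x y, adj G x y -> x \in W
            & {in W &, forall x y, connect (adj G) x y}]
          (connected_on W G).
Proof.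
apply: (iffP and3P) => [[sG /forall_inP inW /forall_inP cG]|[sG inW cG]]; split=> //.
- by move=> x y /inW; rewrite subUset sub1set => /andP[].
- by move=> x y /cG /forall_inP; apply.
- apply/forall_inP => e /(simple_edge sG)[x [y [_ xy ->]]].
  by rewrite subUset !sub1set (inW _ _ xy); move: xy; rewrite adjC => /inW.
- by apply/forall_inP => x xW; apply/forall_inP => y; apply: cG.
Qed.

(** A boolean relation on the finite type of graphs, so that [connect] expresses the existence of a
    switch sequence through graphs connected on [W]. *)
Definition switch_step W G H :=
  [&& connected_on W G, connected_on W H &
      [exists a, exists b, exists c, exists d,
         interchangeable G a b c d && (H == two_switch a b c d G)]].

Lemma switch_stepP W G H :
  reflect [/\ connected_on W G, connected_on W H
            & exists a b c d, interchangeable G a b c d /\ H = two_switch a b c d G]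
          (switch_step W G H).
Proof.
apply: (iffP and3P) => [[cG cH /existsP[a /existsP[b /existsP[c /existsP[d]]]]]|].
  by case/andP=> I /eqP HE; split=> //; exists a, b, c, d.
case=> cG cH [a [b [c [d [I HE]]]]]; split=> //; apply/existsP; exists a.
by apply/existsP; exists b; apply/existsP; exists c; apply/existsP; exists d; rewrite I HE /=.
Qed.

Lemma switch_connect_sym W : connect_sym (switch_step W).
Proof.
apply: sym_connect_sym => G H; apply/idP/idP; move: G H;
  suff sym G H : switch_step W G H -> switch_step W H G by move=> *; apply: sym.
all: case/switch_stepP=> cG cH [a [b [c [d [I HE]]]]].
all: have [sG _ _] := connected_onP _ _ cG; have [I' K] := two_switchK sG I.
all: by apply/switch_stepP; split=> //; exists a, c, b, d; rewrite HE K.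
Qed.

Lemma two_switch_connected_on W G a b c d :
  connected_on W G -> interchangeable G a b c d ->
  (forall u w, adj G u w -> connect (adj (two_switch a b c d G)) u w) ->
  connected_on W (two_switch a b c d G).
Proof.
case/connected_onP=> sG inW cG I sub; apply/connected_onP; split.
- exact: two_switch_simple.
- have /and5P[ab cd _ _ _] := I; move=> x y; rewrite adj_two_switch //.
  have := (inW _ _ ab, inW _ _ cd); rewrite adjC in ab; rewrite adjC in cd.
  have := (inW _ _ ab, inW _ _ cd) => -[bW dW] [aW cW].
  by case/or3P=> [/and3P[_ _ /inW //]||] /orP[]/andP[/eqP->].
- by move=> x y xW yW; apply: connect_sub (cG x y xW yW); apply: sub.
Qed.

Lemma nbr_two_switch G v a b x w : simple_graph G -> interchangeable G v a b x ->
  adj (two_switch v a b x G) v w = (w == b) || (w != a) && adj G v w.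
Proof.
move=> sG I; have := interchangeable_uniq sG I; rewrite adj_two_switch //.
rewrite /= !inE !negb_or => /and4P[/and3P[va vb vx] _ _ _].
by rewrite eqxx (negPf va) (negPf vb) (negPf vx) /= !orbF andbT [RHS]orbC.
Qed.

(** The surviving path from [a] to [b], with the new edges [vb] and [ax], puts all four vertices in
    one component; this bypasses the lost edges [va] and [bx]. *)
Lemma switch_keep_connected W G v a b x :
  connected_on W G -> interchangeable G v a b x ->
  connect (adj (G :\ edge v a :\ edge b x)) a b ->
  connected_on W (two_switch v a b x G).
Proof.
move=> cG I cab; apply: two_switch_connected_on => // u w uw.
set H := two_switch _ _ _ _ _.
have subH y z : adj (G :\ edge v a :\ edge b x) y z -> connect (adj H) y z.
  by rewrite !adjD1 => /and3P[n1 n2 yz]; apply: connect1; rewrite adj_two_switch // n1 n2 yz.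
have {}cab : connect (adj H) a b := connect_sub subH cab.
have vb : connect (adj H) v b by apply: connect1; rewrite adj_two_switch // !eqxx !orbT.
have ax : connect (adj H) a x by apply: connect1; rewrite adj_two_switch // !eqxx !orbT.
have Hs := @adj_connect_sym H.
have va : connect (adj H) v a by apply: connect_trans vb _; rewrite Hs.
have bx : connect (adj H) b x by apply: connect_trans _ ax; rewrite Hs.
have [|n1] := boolP ((u == v) && (w == a) || (u == a) && (w == v)).
  by case/orP=> /andP[/eqP-> /eqP->] //; rewrite Hs.
have [|n2] := boolP ((u == b) && (w == x) || (u == x) && (w == b)).
  by case/orP=> /andP[/eqP-> /eqP->] //; rewrite Hs.
by apply: subH; rewrite !adjD1 n1 n2.
Qed.

(** * The exchange step *)

(** Dropping [a] from the neighbours of [b], and [b] from those of [a], cancels a possible edge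
    [ab]. The first set cannot lie inside the second: the inclusion would be proper because of [v],
    against the degree condition. *)
Lemma nbr_exchange G v a b :
  simple_graph G -> adj G v a -> ~~ adj G v b -> v != b -> deg G a <= deg G b ->
  exists x, [/\ adj G b x, ~~ adj G a x & x != a].
Proof.
move=> sG va vb nvb dab; have vnb : v \notin nbr G b by rewrite inE adjC.
have /subsetPn[x] : ~~ (nbr G b :\ a \subset nbr G a :\ b).
  apply: contraL dab => sub; rewrite -ltnNge !deg_nbr //.
  rewrite (cardsD1 b (nbr G a)) (cardsD1 a (nbr G b)) !inE adjC ltn_add2l.
  apply: proper_card; rewrite properE sub; apply/subsetPn; exists v.
    by rewrite !inE nvb adjC.
  by rewrite in_setD1 (negPf vnb) andbF.
rewrite !inE negb_and negbK => /andP[xa bx] /orP[/eqP xb|]; last by exists x.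
by move: bx; rewrite xb => /(adj_neq sG); rewrite eqxx.
Qed.

Lemma path_avoid G b x y p :
  path (adj G) y p -> b \notin y :: p -> path (adj (G :\ edge b x)) y p.
Proof.
move=> yp nb; apply: (sub_in_path (P := fun z => z != b)) yp => [u w|].
  by rewrite !unfold_in => /negPf ub /negPf wb uw; rewrite adjD1 uw ub wb /= andbF.
by apply/allP => z zp; apply: contraNneq nb => <-.
Qed.

(** Three cases. If [a], [b] are adjacent, the edge [ab] survives; if they have a common neighbour
    [z], the path [a], [z], [b] survives; in both, any exchange neighbour [x0] will do. Otherwise a
    simple path from [b] to [a] is kept and [x] is a neighbour of [b] off its first edge. *)
Lemma path_edge_avoid G v a b :
  simple_graph G -> adj G v a -> ~~ adj G v b -> v != b -> a != b ->
  deg G a <= deg G b -> connect (adj (G :\ edge v a)) a b ->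
  exists x, [/\ adj G b x, ~~ adj G a x, x != a
              & connect (adj (G :\ edge v a :\ edge b x)) a b].
Proof.
move=> sG va vb nvb nab dab cab; have [x0 [bx0 ax0 nx0a]] := nbr_exchange sG va vb nvb dab.
have [ab|nadj] := boolP (adj G a b).
  exists x0; split=> //; apply/connect1/(adjD1_avoid (set22 b x0)).
  - by rewrite eq_sym.
  - exact: adj_neq bx0.
  - by apply: (adjD1_avoid (set21 v a)) ab; rewrite eq_sym // (adj_neq sG va).
have [/existsP[z /andP[az bz]]|nz] := boolP [exists z, adj G a z && adj G b z].
  have nzv : z != v by apply: contraNneq vb => <-; rewrite adjC.
  have nzx0 : z != x0 by apply: contraNneq ax0 => <-.
  exists x0; split=> //; apply: (connect_trans (connect1 (y := z) _)); last apply: connect1.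
    apply: (adjD1_avoid (set22 b x0)) => //; first by rewrite eq_sym.
    by apply: (adjD1_avoid (set21 v a)) az; rewrite // eq_sym (adj_neq sG va).
  rewrite adjC; apply: (adjD1_avoid (set22 b x0)) => //; first exact: adj_neq bx0.
  by apply: (adjD1_avoid (set21 v a)) bz; rewrite // eq_sym.
(* Both [v] and the first vertex of a path from [a] to [b] in [G] minus [va] are neighbours of [a],
   so [b] too has degree at least 2. *)
have : 1 < #|nbr G b|.
  rewrite -(deg_nbr _ sG) (leq_trans _ dab) // deg_nbr //.
  have /connectP[[|w p]] := cab; first by move=> _ ba; rewrite ba eqxx in nab.
  rewrite /= adjD1 => /andP[/andP[+ aw] _] _; rewrite eqxx /= negb_or => /andP[_ wv].
  by apply/card_gt1P; exists v, w; rewrite !inE [adj G a v]adjC eq_sym; split.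
move: cab; rewrite adj_connect_sym => /connectP[p0 /shortenP[[|y p] /=]].
  by move=> _ _ _ ba; rewrite ba eqxx in nab.
rewrite -[b \notin _]/(b \notin y :: p) => /andP[by_ yp] /andP[nb _] _ aE /card_gt1P[x1 [x2 [bx1 bx2 x12]]].
(* Any neighbour of [b] other than [y] works: it is not adjacent to [a], since there are no common
   neighbours, and the path after [y] avoids [b], hence the edge [bx]. *)
have [x [bx xy]] : exists x, adj G b x /\ x != y.
  rewrite !inE in bx1 bx2.
  have [E|] := eqVneq x1 y; last by exists x1.
  by exists x2; rewrite -E eq_sym.
exists x; split=> //.
- by apply: contra nz => ax; apply/existsP; exists x; rewrite ax.
- by apply: contraNneq nadj => <-; rewrite adjC.
rewrite adj_connect_sym; apply: (connect_trans (connect1 (y := y) _)).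
  rewrite adjD1 by_ andbT [y == x]eq_sym (negPf xy) andbF /=.
  by apply: contra nb => /andP[_ /eqP->]; rewrite inE eqxx.
by apply/connectP; exists p => //; apply: path_avoid.
Qed.

Lemma switch_neighbor W G v a b :
  connected_on W G -> adj G v a -> ~~ adj G v b -> v != b -> a != b ->
  deg G a <= deg G b -> connect (adj (G :\ edge v a)) a b ->
  exists H, switch_step W G H /\
    (forall w, adj H v w = (w == b) || (w != a) && adj G v w).
Proof.
move=> cG va vb nvb nab dab cab; have /connected_onP[sG _ _] := cG.
have [x [bx ax nxa cabx]] := path_edge_avoid sG va vb nvb nab dab cab.
have I : interchangeable G v a b x.
  apply: interchangeableI => //; rewrite /= !inE !negb_or nvb (adj_neq sG va) nab.
  rewrite (adj_neq sG bx) [a == x]eq_sym nxa /= andbT.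
  (* [x] differs from [v] because it is adjacent to [b]. *)
  by apply: contraNneq vb => ->; rewrite adjC.
exists (two_switch v a b x G); split; last by move=> w; apply: nbr_two_switch.
apply/switch_stepP; split=> //; first exact: switch_keep_connected.
by exists v, a, b, x.
Qed.

(** * Vertex deletion *)

Definition del_vertex G v : graph n := [set e in G | v \notin e].

Definition star v N : graph n := [set edge v w | w in N].

Lemma adj_del_vertex G v x y :
  adj (del_vertex G v) x y = [&& x != v, y != v & adj G x y].
Proof. by rewrite /adj !inE negb_or andbC ![v == _]eq_sym andbA. Qed.

Lemma del_vertex_sub G v : del_vertex G v \subset G.
Proof. by apply/subsetP => e; rewrite !inE => /andP[]. Qed.

Lemma adj_setU G H x y : adj (G :|: H) x y = adj G x y || adj H x y.
Proof. exact: in_setU. Qed.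

Lemma adj_star v N x y :
  adj (star v N) x y = (x == v) && (y \in N) || (y == v) && (x \in N).
Proof.
apply/imsetP/orP => [[w wN /eqP]|[]/andP[/eqP-> wN]].
- by rewrite eq_set2 => /orP[/andP[-> /eqP->]|/andP[/eqP-> ->]]; [left | right].
- by exists y.
- by exists x; rewrite // setUC.
Qed.

Lemma del_vertex_star G v :
  simple_graph G -> del_vertex G v :|: star v (nbr G v) = G.
Proof.
move=> sG; apply/setP => e; rewrite !inE; apply/orP/idP => [[/andP[]//|]|eG].
  by case/imsetP => w; rewrite inE => vw ->.
have [ve|] := boolP (v \in e); last by left; rewrite eG.
right; have [x [y [_ xy E]]] := simple_edge sG eG.
move: ve; rewrite E !inE => /orP[]/eqP->; apply/imsetP.
  by exists y; rewrite ?inE.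
by exists x; rewrite ?inE 1?adjC // /edge setUC.
Qed.

Lemma deg_del_vertex G v w :
  simple_graph G -> w != v -> deg G w = adj G v w + deg (del_vertex G v) w.
Proof.
move=> sG wv; rewrite !deg_nbr //; last by exact: simple_sub (del_vertex_sub G v) sG.
rewrite (cardsD1 v) inE adjC; congr (_ + _); apply: eq_card => x.
by rewrite !inE adj_del_vertex wv.
Qed.

Lemma deg_del_vertex_self G v : deg (del_vertex G v) v = 0.
Proof.
by apply: eq_card0 => e; rewrite !inE -andbA andNb andbF.
Qed.

Lemma card_del_vertex G v : #|G| = deg G v + #|del_vertex G v|.
Proof.
rewrite /deg setIdE -(cardsID [set e : {set 'I_n} | v \in e] G); congr (_ + _).
by congr #|pred_of_set _|; apply/setP => e; rewrite !inE andbC.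
Qed.

Lemma deg_out W G v : connected_on W G -> v \notin W -> deg G v = 0.
Proof.
case/connected_onP=> sG inW _ vW; rewrite deg_nbr //; apply: eq_card0 => w.
by rewrite !inE; apply: contraNF vW => /inW.
Qed.

Lemma sum_deg W G : connected_on W G -> \sum_(v in W) deg G v = #|G| * 2.
Proof.
case/and3P=> /forall_inP sG /forall_inP inW _.
rewrite handshake -sum_nat_const; apply: eq_bigr => e eG.
by rewrite (setIidPl (inW e eG)) (eqP (sG e eG)).
Qed.

Lemma eq_deg_card W G H : connected_on W G -> connected_on W H ->
  (forall v, deg G v = deg H v) -> #|G| = #|H|.
Proof.
move=> cG cH E; apply/eqP; rewrite -(eqn_pmul2r (m := 2)) // -!(sum_deg (W := W)) //.
by apply/eqP/eq_bigr.
Qed.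

Lemma connected_on_nbr W G v :
  connected_on W G -> v \in W -> 1 < #|W| -> exists a, adj G v a.
Proof.
case/connected_onP=> sG inW cG vW /card_gt1P[x [y [xW yW xy]]].
have [w wW wv] : exists2 w, w \in W & w != v.
  by have [E|] := eqVneq x v; [exists y; rewrite // -E eq_sym | exists x].
have /connectP[[|a p]] := cG v w vW wW; first by move=> _ E; rewrite E eqxx in wv.
by case/andP; exists a.
Qed.

Lemma leaf_nbr G v a w :
  simple_graph G -> deg G v = 1 -> adj G v a -> adj G v w -> w = a.
Proof.
move=> sG; rewrite deg_nbr // => /eqP/cards1P[x E].
have in_nbr y : adj G v y -> y = x by move=> vy; apply/set1P; rewrite -E inE.
by move=> /in_nbr-> /in_nbr.
Qed.

(* Retract the leaf [v] onto its neighbour [a]. *)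
Lemma leaf_del_connect G v a x y :
  simple_graph G -> adj G v a -> (forall w, adj G v w -> w = a) ->
  x != v -> y != v -> connect (adj G) x y -> connect (adj (del_vertex G v)) x y.
Proof.
move=> sG va onlya xv yv xy; pose f z := if z == v then a else z.
have av : a != v by rewrite eq_sym (adj_neq sG va).
have -> : x = f x by rewrite /f (negPf xv).
have -> : y = f y by rewrite /f (negPf yv).
apply: connect_homo xy => u w uw; rewrite /f.
case: (eqVneq u v) uw => [->|uv uw].
  by move=> /onlya->; rewrite (negPf av).
case: (eqVneq w v) uw => [->|wv uw].
  by rewrite adjC => /onlya->.
by apply: connect1; rewrite adj_del_vertex uv wv.
Qed.

Lemma connected_on_del W G v : connected_on W G ->
  {in W :\ v &, forall x y, connect (adj (del_vertex G v)) x y} ->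
  connected_on (W :\ v) (del_vertex G v).
Proof.
case/connected_onP=> sG inW _ cdel; apply/connected_onP; split=> //.
  by exact: simple_sub (del_vertex_sub G v) sG.
by move=> x y; rewrite adj_del_vertex in_setD1 => /and3P[-> _ /inW].
Qed.

Section Star.
Variables (W N : {set 'I_n}) (v : 'I_n).
Hypotheses (vW : v \in W) (sNW : N \subset W :\ v) (N0 : N != set0).

Lemma connected_on_star G : connected_on (W :\ v) G -> connected_on W (G :|: star v N).
Proof.
case/connected_onP=> sG inW cG; have sN w : w \in N -> (w != v) && (w \in W).
  by move=> /(subsetP sNW); rewrite in_setD1.
have [w0 w0N] := set0Pn _ N0.
apply/connected_onP; split.
- apply/forall_inP => e; rewrite inE => /orP[/(forall_inP sG)//|/imsetP[w /sN/andP[wv _] ->]].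
  by rewrite cards2 [v == w]eq_sym wv.
- move=> x y; rewrite adj_setU adj_star => /orP[/inW|]; first by case/setD1P.
  by case/orP=> [/andP[/eqP-> _]|/andP[_ /sN/andP[]]].
have cw0 x : x \in W -> connect (adj (G :|: star v N)) x w0.
  move=> xW; have [->|xv] := eqVneq x v.
    by apply: connect1; rewrite adj_setU adj_star eqxx w0N orbT.
  apply: (connect_adj_sub (subsetUl _ _)); apply: cG; last exact: (subsetP sNW).
  by rewrite in_setD1 xv.
by move=> x y /cw0 xw /cw0 yw; apply: connect_trans xw _; rewrite adj_connect_sym.
Qed.

(** A switch on [W :\ v] touches no edge at [v], so it commutes with adding the star; the star is
    nonempty, so connectivity persists. *)
Lemma switch_step_star G H :
  switch_step (W :\ v) G H -> switch_step W (G :|: star v N) (H :|: star v N).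
Proof.
case/switch_stepP=> cG cH [a [b [c [d [I HE]]]]].
have [sG inW _] := connected_onP _ _ cG.
have cGs := connected_on_star cG; have cHs := connected_on_star cH.
have [[sGs _ _] [sHs _ _]] := (connected_onP _ _ cGs, connected_onP _ _ cHs).
have /and5P[ab cd _ ac bd] := I.
have [/setD1P[av _] /setD1P[cv _]] := (inW _ _ ab, inW _ _ cd).
have bv : b != v by move: ab; rewrite adjC => /inW/setD1P[].
have dv : d != v by move: cd; rewrite adjC => /inW/setD1P[].
have I' : interchangeable (G :|: star v N) a b c d.
  apply: interchangeableI; rewrite ?adj_setU ?ab ?cd ?adj_star ?(negPf av) ?(negPf bv) //.
  - exact: interchangeable_uniq I.
  - by rewrite (negPf ac) (negPf cv).
  - by rewrite (negPf bd) (negPf dv).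
apply/switch_stepP; split=> //; exists a, b, c, d; split=> //.
apply: graph_eq => //; first exact: two_switch_simple.
move=> x y; rewrite HE adj_two_switch // !adj_setU adj_two_switch // adj_star.
(* A pair belonging to the star contains [v], hence is none of the four switched pairs. *)
have [S|_] := boolP (_ && (y \in N) || _ && (x \in N)); last by rewrite !orbF.
have E p q : p != v -> q != v -> ((x == p) && (y == q) || (x == q) && (y == p)) = false.
  move=> /negPf pv /negPf qv; apply/negbTE/negP => XY; move: S.
  by case/orP: XY => /andP[/eqP-> /eqP->]; rewrite pv qv.
by rewrite !E ?orbT.
Qed.

End Star.

Lemma switch_connect_del W G H v a :
  connected_on W G -> connected_on W H -> v \in W -> adj G v a ->
  (forall w, adj G v w = adj H v w) ->
  connect (switch_step (W :\ v)) (del_vertex G v) (del_vertex H v) ->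
  connect (switch_step W) G H.
Proof.
move=> /connected_onP[sG inW _] /connected_onP[sH _ _] vW va E.
rewrite -{2}(del_vertex_star v sG) -{2}(del_vertex_star v sH).
have -> : nbr H v = nbr G v by apply/setP => w; rewrite !inE E.
apply: (connect_homo (f := fun K => K :|: star v (nbr G v))) => K K' KK'.
apply: connect1; apply: switch_step_star KK' => //.
  apply/subsetP => w; rewrite !inE => vw; rewrite eq_sym (adj_neq sG vw) /=.
  by move: vw; rewrite adjC => /inW.
by apply/set0Pn; exists a; rewrite inE.
Qed.

(** * The induction hypothesis and the case of a leaf *)

(** The edge bound is an inequality, so that it covers trees as well as unicyclic graphs and passes
    to [W :\ v]: deleting [v] removes one vertex and at least one edge. *)
Definition switch_connected W := forall G H,
  connected_on W G -> connected_on W H -> (forall v, deg G v = deg H v) ->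
  #|G| <= #|W| -> connect (switch_step W) G H.

(** The common end of both cases of the induction: once the neighbourhoods of [v] agree, the deleted
    graphs have equal degrees and the star at [v] is put back. *)
Lemma switch_connected_del W v G H a :
  switch_connected (W :\ v) -> v \in W -> connected_on W G -> connected_on W H ->
  (forall v, deg G v = deg H v) -> #|G| <= #|W| -> adj G v a ->
  (forall w, adj G v w = adj H v w) ->
  {in W :\ v &, forall x y, connect (adj (del_vertex G v)) x y} ->
  {in W :\ v &, forall x y, connect (adj (del_vertex H v)) x y} ->
  connect (switch_step W) G H.
Proof.
move=> IH vW cG cH dGH leG va E cdG cdH.
have [sG _ _] := connected_onP _ _ cG; have [sH _ _] := connected_onP _ _ cH.
apply: (switch_connect_del cG cH vW va E); apply: IH; try exact: connected_on_del.
  move=> w; have [->|wv] := eqVneq w v; first by rewrite !deg_del_vertex_self.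
  by have := dGH w; rewrite (deg_del_vertex sG wv) (deg_del_vertex sH wv) E => /addnI.
have : 0 < deg G v by rewrite deg_nbr //; apply/card_gt0P; exists a; rewrite inE.
move: leG; rewrite (cardsD1 v W) vW (card_del_vertex G v).
by case: (deg G v) => // k; rewrite addSn add1n ltnS => le _; apply: leq_trans le; apply: leq_addl.
Qed.

(** The leaf [v] hangs at [a] in [G] and at [b] in [H]. If these differ, a single exchange step
    moves it from [a] to [b]. *)
Lemma leaf_switch_connected W v G H a b :
  switch_connected (W :\ v) -> v \in W -> connected_on W G -> connected_on W H ->
  (forall v, deg G v = deg H v) -> #|G| <= #|W| -> deg G v = 1 ->
  adj G v a -> adj H v b -> deg G a <= deg G b ->
  connect (switch_step W) G H.
Proof.
move=> IH vW cG cH dGH leG dv va vb dab.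
have [sG inG kG] := connected_onP _ _ cG; have [sH inH kH] := connected_onP _ _ cH.
have onlya w : adj G v w -> w = a by apply: leaf_nbr.
have onlyb w : adj H v w -> w = b by apply: leaf_nbr; rewrite // -dGH.
have del_conn K c : connected_on W K -> adj K v c -> (forall w, adj K v w -> w = c) ->
    {in W :\ v &, forall x y, connect (adj (del_vertex K v)) x y}.
  case/connected_onP=> sK _ kK vc onlyc x y /setD1P[xv xW] /setD1P[yv yW].
  by apply: leaf_del_connect vc onlyc xv yv _; rewrite ?kK.
have [Eab|nab] := eqVneq a b.
  apply: (switch_connected_del IH vW cG cH dGH leG va).
    by move=> w; apply/idP/idP => [/onlya->|/onlyb->]; rewrite // -?Eab // Eab.
    exact: del_conn _ _ cG va onlya.
  exact: del_conn _ _ cH vb onlyb.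
have nvb : ~~ adj G v b by apply: contraNN nab => /onlya->.
have neq_vb := adj_neq sH vb; have neq_va := adj_neq sG va.
(* Paths between other vertices need not visit the leaf [v], so they survive the loss of [va]. *)
have cab : connect (adj (G :\ edge v a)) a b.
  have : connect (adj (del_vertex G v)) a b.
    apply: (leaf_del_connect sG va onlya); rewrite 1?eq_sym //.
    by apply: kG; [move: va; rewrite adjC => /inG | move: vb; rewrite adjC => /inH].
  apply: connect_sub => x y; rewrite adj_del_vertex => /and3P[xv yv xy].
  by apply: connect1; apply: adjD1_avoid xy; first exact: set21.
have [G1 [st E1]] := switch_neighbor cG va nvb neq_vb nab dab cab.
apply: connect_trans (connect1 st) _.
have [_ cG1 [p [q [r [s [_ G1E]]]]]] := switch_stepP _ _ _ st.
have {G1E} dG1 w : deg G1 w = deg G w by rewrite G1E deg_two_switch.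
have {}E1 w : adj G1 v w = (w == b).
  rewrite E1 (_ : _ && _ = false) ?orbF //.
  by apply/negP => /andP[/eqP wa /onlya].
have vb1 : adj G1 v b by rewrite E1.
apply: (switch_connected_del IH vW cG1 cH _ _ vb1).
- by move=> w; rewrite dG1.
- by rewrite (eq_deg_card cG1 cG).
- by move=> w; rewrite E1; apply/eqP/idP => [->|/onlyb].
- by apply: (del_conn _ _ cG1 vb1) => w; rewrite E1 => /eqP.
- exact: del_conn _ _ cH vb onlyb.
Qed.

(** * Cycles *)

(** Even degrees exclude bridges, so one edge [vb] can be removed; then [v] is a leaf at its other
    neighbour [c], and deleting a leaf preserves connectivity. *)
Lemma cycle_del_connect W G v x y :
  connected_on W G -> (forall w, 2 %| deg G w) -> deg G v = 2 ->
  x \in W :\ v -> y \in W :\ v -> connect (adj (del_vertex G v)) x y.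
Proof.
case/connected_onP=> sG inW cG evG dv /setD1P[xv xW] /setD1P[yv yW].
have /cards2P[b [c [bc E]]] : #|nbr G v| == 2 by rewrite -deg_nbr // dv.
have [vb vc] : adj G v b /\ adj G v c.
  by have := set21 b c; have := set22 b c; rewrite -E !inE.
have sG' := simple_sub (subsetDl G [set edge v b]) sG.
apply: (connect_adj_sub (H := del_vertex (G :\ edge v b) v)).
  by apply/subsetP => e; rewrite !inE => /andP[/andP[_ ->]].
have neq_bv : b != v by rewrite eq_sym (adj_neq sG vb).
apply: (leaf_del_connect (a := c)) => //.
- by rewrite adjD1 vc eqxx /= [c == b]eq_sym (negPf bc) andbT eq_sym (negPf neq_bv).
- move=> w; rewrite adjD1 eqxx /= negb_or => /andP[/andP[wb _] vw].
  have : w \in nbr G v by rewrite inE.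
  by rewrite E !inE (negPf wb) => /eqP.
by apply: connect_setD1; [apply: even_nonbridge | apply: cG].
Qed.

(** Induction on the number of neighbours of [v] in [G] that are not neighbours in [H]. As all
    degrees on [W] are 2, the degree condition of the exchange step is an equality and no edge is a
    bridge. *)
Lemma cycle_align W H v :
  v \in W -> connected_on W H -> (forall w, deg H w = (w \in W) * 2) ->
  forall G, connected_on W G -> (forall w, deg G w = deg H w) ->
  exists K, [/\ connect (switch_step W) G K, connected_on W K,
                forall w, deg K w = deg H w & forall w, adj K v w = adj H v w].
Proof.
move=> vW cH dH G; have [k] := ubnP #|nbr G v :\: nbr H v|.
have [sH inH _] := connected_onP _ _ cH.
elim: k G => // k IHk G lek cG dGH; have [sG inG kG] := connected_onP _ _ cG.
have cardv : #|nbr G v| = #|nbr H v| by rewrite -!deg_nbr.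
have [sub|/subsetPn[a aG aH]] := boolP (nbr G v \subset nbr H v).
  exists G; split=> // w.
  have : nbr G v = nbr H v by apply/eqP; rewrite eqEcard sub cardv leqnn.
  by move/setP/(_ w); rewrite !inE.
(* The two neighbourhoods have equal size, so a surplus neighbour [a] forces a missing one [b]. *)
have /subsetPn[b bH bG] : ~~ (nbr H v \subset nbr G v).
  by apply: contraNN aH => sub; have /eqP -> : nbr H v == nbr G v by rewrite eqEcard sub cardv leqnn.
have [va vb nvb] : [/\ adj G v a, adj H v b & ~~ adj G v b].
  by move: aG bH bG; rewrite !inE.
have aW : a \in W by move: va; rewrite adjC => /inG.
have bW : b \in W by move: vb; rewrite adjC => /inH.
have nab : a != b by apply: contraNneq nvb => <-.
have cab : connect (adj (G :\ edge v a)) a b.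
  apply: connect_setD1; last exact: kG.
  by apply: even_nonbridge => // w; rewrite dGH dH dvdn_mull.
have dab : deg G a <= deg G b by rewrite !dGH !dH aW bW.
have [G1 [st E1]] := switch_neighbor cG va nvb (adj_neq sH vb) nab dab cab.
have [_ cG1 [p [q [r [s [_ G1E]]]]]] := switch_stepP _ _ _ st.
have [||K [GK cK dK EK]] := IHk G1 _ cG1; last 1 first.
- by exists K; split=> //; apply: connect_trans (connect1 st) GK.
(* The difference loses [a], and the new neighbour [b] lies in [nbr H v]. *)
- rewrite ltnS in lek; apply: leq_trans lek; rewrite [X in _ < X](cardsD1 a) !inE va.
  rewrite inE in aH; rewrite aH add1n ltnS; apply/subset_leq_card/subsetP => w.
  rewrite !inE E1 => /andP[wH /orP[/eqP wb|/andP[-> ->]]]; last by rewrite wH.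
  by rewrite wb vb in wH.
- by move=> w; rewrite G1E deg_two_switch.
Qed.

(** The degree sum is at most [#|W| * 2], so a degree above 2 would have to be offset by one below
    2. *)
Lemma degree_two W G :
  connected_on W G -> #|G| <= #|W| -> {in W, forall v, 1 < deg G v} ->
  forall v, deg G v = (v \in W) * 2.
Proof.
move=> cG leG d2 v; have [vW|vW] := boolP (v \in W); last by rewrite (deg_out cG).
apply/eqP; rewrite eqn_leq d2 // andbT leqNgt; apply/negP => d3.
have: #|W| * 2 < \sum_(w in W) deg G w; last by rewrite (sum_deg cG) ltn_pmul2r // ltnNge leG.
rewrite -sum_nat_const (bigD1 v) //= [X in _ < X](bigD1 v) //=.
rewrite -addSn; apply: leq_add => //; apply: leq_sum => w /andP[wW _]; exact: d2.
Qed.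

(** * The induction on the vertex set *)

Lemma all_switch_connected W : switch_connected W.
Proof.
have [m] := ubnP #|W|; elim: m W => // m IHm W leW G H cG cH dGH leG.
have [sG inG _] := connected_onP _ _ cG; have [sH inH _] := connected_onP _ _ cH.
(* On at most one vertex there are no edges, so the two graphs coincide. *)
have [/card_le1_eqP W1|W2] := leqP #|W| 1.
  have no_adj K x y : connected_on W K -> adj K x y = false.
    case/connected_onP=> sK inK _; apply/negP => xy; have := adj_neq sK xy.
    by rewrite (W1 x y (inK _ _ xy)) ?eqxx //; move: xy; rewrite adjC => /inK.
  by rewrite (@graph_eq G H) // => x y; rewrite !no_adj.
have IH v : v \in W -> switch_connected (W :\ v).
  by move=> vW; apply: IHm; move: leW; rewrite (cardsD1 v) vW.
have [/existsP[v /andP[vW /eqP dv]]|nleaf] := boolP [exists v, (v \in W) && (deg G v == 1)].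
  have [a va] := connected_on_nbr cG vW W2; have [b vb] := connected_on_nbr cH vW W2.
  have [dab|/ltnW dba] := leqP (deg G a) (deg G b).
    exact: leaf_switch_connected (IH v vW) vW cG cH dGH leG dv va vb dab.
  (* The degree condition holds with [G] and [H] exchanged, so the leaf is moved in [H] instead. *)
  rewrite switch_connect_sym.
  apply: (leaf_switch_connected (IH v vW) vW cH cG _ _ _ vb va) => //.
  - by rewrite -(eq_deg_card cG cH).
  - by rewrite -dGH.
  - by rewrite -!dGH.
have d2 : forall w, deg G w = (w \in W) * 2.
  apply: degree_two => // v vW; have [a va] := connected_on_nbr cG vW W2.
  have : 0 < deg G v by rewrite deg_nbr //; apply/card_gt0P; exists a; rewrite inE.
  rewrite leq_eqVlt => /orP[/eqP dv|//]; case/negP: nleaf; apply/existsP.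
  by exists v; rewrite vW -dv.
have [v vW] : exists v, v \in W by apply/card_gt0P; apply: ltnW.
have dH2 w : deg H w = (w \in W) * 2 by rewrite -dGH.
have [K [GK cK dKH EK]] := cycle_align vW cH dH2 cG dGH.
apply: connect_trans GK _; have [a va] := connected_on_nbr cK vW W2.
have del_conn L : connected_on W L -> (forall w, deg L w = deg H w) ->
    {in W :\ v &, forall x y, connect (adj (del_vertex L v)) x y}.
  move=> cL dL x y xW yW; apply: (cycle_del_connect cL) => // [w|].
    by rewrite dL dH2 dvdn_mull.
  by rewrite dL dH2 vW.
apply: (switch_connected_del (IH v vW) vW cK cH dKH _ va EK); try exact: del_conn.
by rewrite (eq_deg_card cK cG) // => w; rewrite dKH.
Qed.

(** * Unicyclic graphs *)

Lemma connected_onT G : connected_on setT G = simple_graph G && connected G.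
Proof.
apply/connected_onP/andP => [[sG _ cG]|[sG /forallP cG]]; split=> //.
  by apply/forallP => x; apply/forallP => y; apply: cG; rewrite inE.
  by move=> x y _; rewrite inE.
by move=> x y _ _; apply: (forallP (cG x)).
Qed.

(** The tree grows from [r] by one vertex and one edge at a time. Being connected with [n - 1] edges
    is the form in which it is used, both to close cycles and to bound edge numbers from below. *)
Lemma spanning_tree G (r : 'I_n) : (forall x y, connect (adj G) x y) ->
  exists T, [/\ T \subset G, #|T|.+1 = n & forall x y, connect (adj T) x y].
Proof.
move=> cG.
have grow k : k < n -> exists (S : {set 'I_n}) T,
    [/\ T \subset G, #|T| = k, #|S| = k.+1, {in T, forall e : {set 'I_n}, e \subset S}
      & r \in S /\ {in S, forall x, connect (adj T) r x}].
  elim: k => [|k IHk] ltkn.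
    exists [set r], set0; rewrite sub0set cards0 cards1 set11; split=> //.
      by move=> e; rewrite inE.
    by split=> // x /set1P->; apply: connect0.
  have [S [T [TG cT cS inS [rS kS]]]] := IHk (ltnW ltkn).
  have /existsP[u /existsP[w /and3P[uS wS uw]]] :
      [exists u, exists w, [&& u \in S, w \notin S & adj G u w]].
    (* If no edge left [S], it would be closed under adjacency and contain every vertex, yet it has
       only [k.+1 < n] elements. *)
    apply: contraLR ltkn => noexit; rewrite -leqNgt -cS -{1}[n]card_ord.
    apply/subset_leq_card/subsetP => y _.
    have cl : closed (adj G) S.
      apply: intro_closed; first exact: adj_connect_sym.
      move=> x z xz xS; apply: contraNT noexit => zS.
      by apply/existsP; exists x; apply/existsP; exists z; rewrite xS zS.
    by rewrite -(closed_connect cl (cG r y)).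
  have uwT : edge u w \notin T.
    by apply: contraNN wS => /inS; rewrite subUset !sub1set => /andP[].
  have sub x y : connect (adj T) x y -> connect (adj (edge u w |: T)) x y.
    by apply: connect_adj_sub; apply: subsetUr.
  exists (w |: S), (edge u w |: T); split.
  - by rewrite subUset sub1set TG andbT; exact: uw.
  - by rewrite cardsU1 uwT cT.
  - by rewrite cardsU1 wS cS.
  - move=> e; rewrite !inE => /orP[/eqP->|/inS eS]; last by rewrite subsetU // eS orbT.
    by rewrite subUset !sub1set !inE uS eqxx orbT.
  split=> [|x]; first by rewrite inE rS orbT.
  rewrite !inE => /orP[/eqP->|/kS /sub //].
  by apply: connect_trans (sub _ _ (kS u uS)) (connect1 _); rewrite /adj !inE eqxx.
have n0 : 0 < n by apply: leq_ltn_trans (ltn_ord r).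
have [S [T [TG cT cS _ [_ kS]]]] := grow n.-1 ltac:(by rewrite prednK).
have ST : S = setT.
  by apply/eqP; rewrite eqEcard subsetT cardsT card_ord cS prednK /=.
have {}kS x : connect (adj T) r x by apply: kS; rewrite ST.
exists T; split=> //; first by rewrite cT prednK.
by move=> x y; apply: connect_trans _ (kS y); rewrite adj_connect_sym.
Qed.

(** * Edge sets of paths and closing a path to a cycle *)

Fixpoint path_edges x (p : seq 'I_n) : graph n :=
  if p is y :: p' then edge x y |: path_edges y p' else set0.

Lemma path_edges_vertex x p e v : e \in path_edges x p -> v \in e -> v \in x :: p.
Proof.
elim: p x => [|y p IHp] x /=; first by rewrite inE.
rewrite !inE => /orP[/eqP->|/IHp IH ve].
  by rewrite !inE => /orP[]->; rewrite ?orbT.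
by rewrite -in_cons IH ?orbT.
Qed.

Lemma path_edges_sub G x p : path (adj G) x p -> path_edges x p \subset G.
Proof.
elim: p x => [|y p IHp] x /=; first by rewrite sub0set.
by case/andP=> xy /IHp; rewrite subUset sub1set => ->; rewrite andbT; exact: xy.
Qed.

Lemma path_edges_connect x p v : v \in x :: p -> connect (adj (path_edges x p)) x v.
Proof.
elim: p x => [|y p IHp] x; first by rewrite inE => /eqP->; apply: connect0.
rewrite inE => /orP[/eqP->|/IHp yv]; first exact: connect0.
apply: (connect_trans (connect1 (y := y) _)); first by rewrite /adj /= !inE eqxx.
by apply: connect_adj_sub yv; apply: subsetUr.
Qed.

(** The two correction terms raise the ends to degree 2, like the interior; for an empty [p] both
    fall on [x], whose degree is 0. *)
Lemma deg_path_edges x p v : uniq (x :: p) ->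
  deg (path_edges x p) v + (v == x) + (v == last x p) = (v \in x :: p) * 2.
Proof.
elim: p x => [|y p IHp] x /=.
  rewrite inE (_ : deg _ v = 0) ?add0n; first by case: (v == x).
  by apply: eq_card0 => e; rewrite !inE.
case/andP=> xp Up; have {IHp} := IHp y Up.
have xyN : edge x y \notin path_edges y p.
  by apply: contraNN xp => /path_edges_vertex; apply; rewrite set21.
have xy : x != y by apply: contraNneq xp => ->; rewrite inE eqxx.
rewrite degU1 // in_set2 [v \in x :: _]inE.
case: (eqVneq v x) => [->|vx] /=; last by rewrite addn0 addnAC addnC addnA addnC [_ + deg _ _]addnC.
by rewrite (negPf xp) (negPf xy) => /eqP; rewrite !addn_eq0 => /andP[/andP[/eqP-> _] /eqP->].
Qed.

Lemma is_cycle_sub G H C : is_cycle G C -> C \subset H -> is_cycle H C.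
Proof. by case/and4P=> _ C0 dC cC CH; apply/and4P. Qed.

(** A simple path from [x] to [y] has degree 2 except at its ends, where the new edge supplies
    exactly what is missing. *)
Lemma cycle_closing G x y : x != y -> connect (adj G) x y -> edge x y \notin G ->
  exists C, is_cycle (edge x y |: G) C.
Proof.
move=> xy /connectP[p0 /shortenP[p xp Up _] yE] xyG.
pose P := path_edges x p; have PG : P \subset G by apply: path_edges_sub.
have xyP : edge x y \notin P by apply: contraNN xyG; apply: (subsetP PG).
have dC v : deg (edge x y |: P) v = (v \in x :: p) * 2.
  rewrite -(deg_path_edges v Up) -yE degU1 // in_set2 -/P addnC -addnA; congr (_ + _).
  by case: (eqVneq v x) => [->|_] //=; rewrite (negPf xy).
have cover_p v : v \in cover (edge x y |: P) -> v \in x :: p.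
  case/bigcupP=> e /setU1P[->|eP ve]; last exact: path_edges_vertex eP ve.
  by rewrite in_set2 => /orP[]/eqP->; rewrite ?mem_head // yE mem_last.
exists (edge x y |: P); apply/and4P; split.
- exact: setUS.
- by apply/set0Pn; exists (edge x y); rewrite setU11.
- by apply/forallP => v; apply/implyP => /cover_p vp; rewrite dC vp.
have cx v : v \in cover (edge x y |: P) -> connect (adj (edge x y |: P)) x v.
  move=> /cover_p /path_edges_connect; apply: connect_adj_sub; exact: subsetUr.
apply/forall_inP => u /cx xu; apply/forall_inP => w /cx; apply: connect_trans.
by rewrite adj_connect_sym.
Qed.

(** All degrees in [C] are even, so [xy] is not a bridge of [C], and the detour inside [C] is
    available in [G]. *)
Lemma cycle_edge_nonbridge G C x y :
  simple_graph G -> is_cycle G C -> adj C x y ->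
  forall u w, connect (adj G) u w -> connect (adj (G :\ edge x y)) u w.
Proof.
move=> sG /and4P[CG _ /forallP dC _] xy; apply: connect_setD1.
apply: (connect_adj_sub (setSD _ CG)); apply: even_nonbridge => //.
  exact: simple_sub sG.
move=> v; have [vC|vC] := boolP (v \in cover C).
  by rewrite (eqP (implyP (dC v) vC)).
rewrite /deg (eq_card0 _) // => e; rewrite !inE; apply: contraNF vC => /andP[eC ve].
by apply/bigcupP; exists e.
Qed.

Lemma cycle_edge G C : simple_graph G -> is_cycle G C ->
  exists x y, adj C x y.
Proof.
move=> sG /and4P[CG /set0Pn[e eC] _ _].
by have [x [y [_ xy _]]] := simple_edge (simple_sub CG sG) eC; exists x, y.
Qed.

(** * Unicyclic graphs as connected graphs with [n] edges *)

(** Removing an edge [xy] of the unique cycle leaves a connected graph. An edge of it outside a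
    spanning tree would close a cycle avoiding [xy], so the remainder is the tree and has [n - 1]
    edges. *)
Lemma unicyclic_card G : unicyclic G -> #|G| = n.
Proof.
case/and3P=> sG /forallP cG /cards1P[C uC].
have cycC D : is_cycle G D -> D = C by move=> cD; apply/set1P; rewrite -uC inE.
have CC : is_cycle G C by have := set11 C; rewrite -uC inE.
have [x [y xy]] := cycle_edge sG CC; have /and4P[CG _ _ _] := CC.
have cG' u w : connect (adj (G :\ edge x y)) u w.
  by apply: (cycle_edge_nonbridge sG CC xy); apply: (forallP (cG u)).
have [T [TG cT kT]] := spanning_tree x cG'.
suff E : T = G :\ edge x y.
  by rewrite (cardsD1 (edge x y)) (adj_sub CG xy : edge x y \in G) -E.
apply/eqP; rewrite eqEsubset TG /=; apply/subsetP => f fG; apply: contraT => fT.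
have [u [w [uw _ fE]]] := simple_edge (simple_sub (subsetDl _ _) sG) fG.
rewrite -/(edge u w) in fE; subst f.
have [D cD] := cycle_closing uw (kT u w) fT.
have DG : D \subset G :\ edge x y.
  have /and4P[DE _ _ _] := cD; apply: subset_trans DE _.
  by rewrite subUset sub1set fG.
have DC := cycC D (is_cycle_sub cD (subset_trans DG (subsetDl _ _))).
by move: (subsetP DG (edge x y)); rewrite DC !inE eqxx => /(_ xy).
Qed.

(** Existence: some edge lies outside a spanning tree and closes a cycle. Uniqueness comes from
    mutual inclusion of any two cycles. *)
Lemma unicyclic_of_card G : 0 < n -> simple_graph G -> connected G -> #|G| = n ->
  unicyclic G.
Proof.
move=> n0 sG /[dup] cG /forallP kG cardG; apply/and3P; split=> //.
have r : 'I_n := Ordinal n0.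
have {}kG x y : connect (adj G) x y := forallP (kG x) y.
have [T [TG cT kT]] := spanning_tree r kG.
have /subsetPn[f fG fT] : ~~ (G \subset T).
  by apply/negP => /subset_leq_card; rewrite cardG leqNgt -[X in _ < X]cT ltnSn.
have [u [w [uw _ fE]]] := simple_edge sG fG; rewrite -/(edge u w) in fE; subst f.
have [C cC] := cycle_closing uw (kT u w) fT.
have {}cC : is_cycle G C.
  have /and4P[CE _ _ _] := cC; apply: (is_cycle_sub cC); apply: subset_trans CE _.
  by rewrite subUset sub1set fG.
(* If [D] had an edge outside [E], removing it and then an edge of [E] would keep the graph
   connected with [n - 2] edges, fewer than a spanning tree has. *)
have sub D E : is_cycle G D -> is_cycle G E -> D \subset E.
  move=> cD cE; apply/subsetP => e eD; apply: contraT => eE.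
  have /and4P[DG _ _ _] := cD; have /and4P[EG _ _ _] := cE.
  have [x [y [_ xy eE']]] := simple_edge (simple_sub DG sG) eD.
  rewrite -/(edge x y) in eE'; subst e.
  have cE' : is_cycle (G :\ edge x y) E.
    by apply: (is_cycle_sub cE); rewrite subsetD1 EG.
  have sG' := simple_sub (subsetDl G [set edge x y]) sG.
  have [z [t zt]] := cycle_edge sG' cE'; have /and4P[EG' _ _ _] := cE'.
  have kG' a b : connect (adj (G :\ edge x y :\ edge z t)) a b.
    by apply: (cycle_edge_nonbridge sG' cE' zt); apply: (cycle_edge_nonbridge sG cD xy).
  have [T' [TG' cT' _]] := spanning_tree r kG'.
  have := subset_leq_card TG'; rewrite -ltnS cT' -[X in X <= _]cardG.
  rewrite (cardsD1 (edge x y)) (adj_sub DG xy : edge x y \in G).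
  by rewrite (cardsD1 (edge z t)) (adj_sub EG' zt : edge z t \in _) !add1n ltnn.
apply/cards1P; exists C; apply/setP => D; rewrite !inE.
apply/idP/eqP => [cD|->//]; apply/eqP; rewrite eqEsubset.
by rewrite !sub.
Qed.

(** Degrees, hence the number [n] of edges, are constant along the sequence, so each connected
    intermediate graph is unicyclic. *)
Lemma switch_steps_u_switch_seq G H : 0 < n -> #|G| = n ->
  connect (switch_step setT) G H -> exists taus, u_switch_seq G taus H.
Proof.
move=> n0 cardG /connectP[p]; elim: p G cardG => [|K p IHp] G cardG /=.
  by move=> _ ->; exists [::] => /=.
case/andP=> /switch_stepP[cG cK [a [b [c [d [I KE]]]]]] Kp HE.
have cardK : #|K| = n.
  rewrite -[RHS]cardG; apply: (eq_deg_card cK cG) => v; rewrite KE deg_two_switch //.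
  by case/connected_onP: cG.
have [taus seq] := IHp K cardK Kp HE; exists ((a, b, c, d) :: taus) => /=.
rewrite -KE seq andbT /u_switch I -KE /=.
by move: cK; rewrite connected_onT => /andP[sK kK]; apply: unicyclic_of_card.
Qed.

End Graphs.

Theorem theorem3p9 (n : nat) (U U' : graph n) :
  unicyclic U -> unicyclic U' -> degseq U = degseq U' ->
  exists taus : seq ('I_n * 'I_n * 'I_n * 'I_n), u_switch_seq U taus U'.
Proof.
move=> uU uU' dE.
have conn (K : graph n) : unicyclic K -> connected_on setT K.
  by case/and3P=> sK cK _; rewrite connected_onT sK.
(* The cycle of [U] has an edge, so there is a vertex. *)
have n0 : 0 < n.
  case/and3P: uU => sU _ /cards1P[C E].
  have cC : is_cycle U C by have := set11 C; rewrite -E inE.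
  by have [x _] := cycle_edge sU cC; apply: leq_ltn_trans (ltn_ord x).
apply: switch_steps_u_switch_seq => //; first exact: unicyclic_card.
apply: all_switch_connected; rewrite ?conn //; last by rewrite cardsT card_ord unicyclic_card.
by move=> v; move/ffunP/(_ v): dE; rewrite !ffunE.
Qed.
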